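(* Let $r\ge 2$ be fixed. The problem \textsc{$r$-SATALB} restricted to exact $r$-CNF formulas $\mathcal{C}$ with $m$ clauses and conflict number $\mathrm{cn}(\mathcal{C})\le (2^r-2)m$ admits a quadratic kernel, i.e., a polynomial-time reduction to an equivalent instance whose number of clauses is $O(k^2)$.
   Context: Variables $x_1,\dots,x_n$ take values in $\{1,-1\}$ (true/false); literals are $x_i$ and $-x_i$. An exact $r$-CNF formula is a set $\mathcal{C}$ of $m$ distinct clauses, each consisting of exactly $r$ distinct literals with no pair of the form $y,-y$. \textsc{$r$-SATALB}: Instance: an exact $r$-CNF formula $\mathcal{C}$ with $m$ clauses and a positive rational $k$ with denominator $2^r$; parameter $k$; question: is there a truth assignment satisfying at least $(1-2^{-r})m+k$ clauses? Two distinct clauses $Y,Z$ have a conflict if some literal $p\in Y$ has $-p\in Z$; they have an overlap if they share a literal but have no conflict. The conflict number is $\mathrm{cn}(\mathcal{C})=c-o$, where $c$ (resp. $o$) is the number of ordered pairs of distinct clauses having a conflict (resp. an overlap). *)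

(* Defs.v *)
From HB Require Import structures.
From mathcomp Require Import all_boot all_order all_algebra.
Set Implicit Arguments. Unset Strict Implicit. Unset Printing Implicit Defensive.
Import Order.TTheory GRing.Theory Num.Theory.

(** * Deterministic multi-tape Turing machines *)

Inductive move := MoveL | MoveN | MoveR.

(* The tape alphabet is the input/output alphabet [S] plus further work
   symbols; [None] is the blank. *)
Record tm (S : finType) := TM {
  tm_state : finType;
  tm_work : finType;
  tm_tapes : nat;
  tm_init : tm_state;
  tm_halt : pred tm_state;
  tm_delta : tm_state -> {ffun 'I_tm_tapes.+1 -> option (S + tm_work)} ->
             tm_state * {ffun 'I_tm_tapes.+1 -> option (S + tm_work) * move}
}.

Definition cell (S : finType) (M : tm S) := option (S + tm_work M).

Record config (S : finType) (M : tm S) := Config {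
  cf_state : tm_state M;
  cf_head : 'I_(tm_tapes M).+1 -> nat;
  cf_tape : 'I_(tm_tapes M).+1 -> nat -> cell M
}.

(* Tapes are infinite to the right only; moving left from cell 0 has no
   effect. *)
Definition move_head (d : move) (p : nat) : nat :=
  match d with MoveL => p.-1 | MoveN => p | MoveR => p.+1 end.

Definition tm_step (S : finType) (M : tm S) (c : config M) : config M :=
  if tm_halt (cf_state c) then c else
  let a := tm_delta (cf_state c) [ffun i => cf_tape c i (cf_head c i)] in
  Config a.1
    (fun i => move_head (a.2 i).2 (cf_head c i))
    (fun i p => if p == cf_head c i then (a.2 i).1 else cf_tape c i p).

Definition tm_word (S : finType) (M : tm S) (w : seq S) (p : nat) : cell M :=
  onth [seq inl x | x <- w] p.

(* The input is on tape [ord0], the output is read from tape [ord_max]. *)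
Definition tm_start (S : finType) (M : tm S) (w : seq S) : config M :=
  Config (tm_init M) (fun=> 0)
    (fun i => if i == ord0 then tm_word M w else fun=> None).

Definition tm_outputs_in (S : finType) (M : tm S) (w : seq S) (t : nat)
    (w' : seq S) : Prop :=
  let c := iter t (@tm_step S M) (tm_start M w) in
  tm_halt (cf_state c) /\ forall p, cf_tape c ord_max p = tm_word M w' p.

Definition poly_time_on (S : finType) (P : seq S -> Prop)
    (f : seq S -> seq S) : Prop :=
  exists (M : tm S) (a d : nat), forall w, P w ->
    exists2 t, t <= a * (size w).+1 ^ d & tm_outputs_in M w t (f w).

(** * Kernelization *)

Local Open Scope ring_scope.

(* [enc w x]: the word [w] is an encoding of the instance [x]; an instance may
   have several encodings.  [h] bounds the measure [sz] of the kernel in terms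
   of the parameter. *)
Definition admits_kernel (X : Type) (S : finType) (enc : seq S -> X -> Prop)
    (inst yes : X -> Prop) (par : X -> rat) (sz : X -> nat) (h : rat -> rat) :
    Prop :=
  exists (f : seq S -> seq S) (g : rat -> rat),
    poly_time_on (fun w => exists2 x, inst x & enc w x) f /\
    forall w x, inst x -> enc w x ->
      exists x', [/\ enc (f w) x', inst x', yes x <-> yes x',
                     par x' <= g (par x) & (sz x')%:R <= h (par x)].

(** * Exact CNF formulas *)

(* [(i, true)] is the literal x_i and [(i, false)] the literal -x_i. *)
Definition literal (n : nat) : finType := ('I_n * bool)%type.

Definition neg_lit (n : nat) (p : literal n) : literal n := (p.1, ~~ p.2).

Definition clause (n : nat) : finType := {set literal n}.

Definition exact_cnf (r n : nat) (C : {set clause n}) : Prop :=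
  forall Y, Y \in C -> #|Y| = r /\ (forall p, p \in Y -> neg_lit p \notin Y).

Definition has_conflict (n : nat) (Y Z : clause n) : bool :=
  [exists p, (p \in Y) && (neg_lit p \in Z)].

Definition has_overlap (n : nat) (Y Z : clause n) : bool :=
  [exists p, (p \in Y) && (p \in Z)] && ~~ has_conflict Y Z.

Definition conflict_number (n : nat) (C : {set clause n}) : int :=
  #|[set YZ in setX C C | (YZ.1 != YZ.2) && has_conflict YZ.1 YZ.2]|%:Z -
  #|[set YZ in setX C C | (YZ.1 != YZ.2) && has_overlap YZ.1 YZ.2]|%:Z.

Definition assignment (n : nat) : finType := {ffun 'I_n -> bool}.

Definition sat_clause (n : nat) (t : assignment n) (Y : clause n) : bool :=
  [exists p, (p \in Y) && (t p.1 == p.2)].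

Definition num_sat (n : nat) (t : assignment n) (C : {set clause n}) : nat :=
  #|[set Y in C | sat_clause t Y]|.

(** * r-SATALB *)

Record instance := Instance {
  nvar : nat;
  formula : {set clause nvar};
  param : rat
}.

Definition num_clauses (x : instance) : nat := #|formula x|.

Definition satalb_instance (r : nat) (x : instance) : Prop :=
  exact_cnf r (formula x) /\
  exists2 j : nat, (0 < j)%N & param x = j%:R / 2 ^+ r.

Definition satalb_yes (r : nat) (x : instance) : Prop :=
  exists t : assignment (nvar x),
    (1 - 2 ^- r) * (num_clauses x)%:R + param x <= (num_sat t (formula x))%:R.

Definition low_conflict (r : nat) (x : instance) : Prop :=
  conflict_number (formula x) <= (2 ^+ r - 2) * (num_clauses x)%:Z.

(** * Encoding of instances as words *)

Definition symbol : finType := (bool + bool + unit)%type.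
Definition bit (b : bool) : symbol := inl (inl b).
Definition sign (b : bool) : symbol := inl (inr b).
Definition sep : symbol := inr tt.

(* Binary notation, least significant bit first, without leading zeros. *)
Definition binary (a : nat) : seq symbol :=
  mkseq (fun i => bit (odd (a %/ 2 ^ i))) (up_log 2 a.+1).

Definition literal_word (n : nat) (p : literal n) : seq symbol :=
  sign p.2 :: binary p.1.

Definition clause_word (n : nat) (s : seq (literal n)) : seq symbol :=
  rcons (flatten [seq literal_word p | p <- s]) sep.

(* [ss] lists the clauses of [C], each exactly once, and each clause of [C] is
   given by a duplicate-free list of its literals. *)
Definition lists_formula (n : nat) (C : {set clause n})
    (ss : seq (seq (literal n))) : bool :=
  all uniq ss && perm_eq [seq [set:: s] | s <- ss] (enum C).

(* The parameter is encoded by its numerator over the fixed denominator 2^r. *)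
Definition encodes (r : nat) (w : seq symbol) (x : instance) : Prop :=
  exists (j : nat) (ss : seq (seq (literal (nvar x)))),
    [/\ param x = j%:R / 2 ^+ r,
        lists_formula (formula x) ss &
        w = binary (nvar x) ++ sep :: binary j ++ sep ::
            flatten [seq clause_word s | s <- ss]].

(* Main.v *)
Require Import Defs.
From HB Require Import structures.
From mathcomp Require Import all_boot all_order all_algebra.
From mathcomp Require Import ring lra zify.
Set Implicit Arguments. Unset Strict Implicit. Unset Printing Implicit Defensive.
Import Order.TTheory GRing.Theory Num.Theory.
Local Open Scope ring_scope.

(** For a uniformly random assignment let [X] be the number of satisfied clauses
    minus its mean [(1 - 2^-r) m].  Two distinct clauses contribute [-4^-r] to
    [E[X^2]] if they conflict, at least [4^-r] if they overlap and [0] otherwise,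
    so [4^r E[X^2] >= (2^r - 1) m - cn(C) >= m].  As [X] is a polynomial of degree
    [r] on the cube, Bonami's lemma gives [E[X^4] <= 9^r E[X^2]^2].  If the answer
    is no then [X < k] everywhere, and since [E[X] = 0] this forces
    [E[X^2] <= 32 * 9^r * k^2]; hence [m <= 32 * 36^r * k^2].

    So with [k = j / 2^r], an instance with [m >= 2^(2 L + c0)], where [L] is the
    bit length of [j] and [c0] depends on [r] only, is a yes-instance and is
    replaced by a fixed one; the others have [m = O(k^2)] and are kept.  A Turing
    machine performs the test with a binary counter of [2 L + c0] bits,
    incremented once per clause: the instance is replaced iff the counter
    overflows. *)

(** * Polynomials on the discrete cube *)

Section Cube.
Variable R : realFieldType.
Implicit Types (n D : nat) (f g h : seq bool -> R).

(** Points of the cube are boolean lists, so that induction on the dimension peels off the first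
    coordinate by [cons]; only lists of size [n] are evaluated. *)
Fixpoint mean n f : R :=
  if n is n'.+1 then
    (mean n' (fun s => f (true :: s)) + mean n' (fun s => f (false :: s))) / 2
  else f [::].

Lemma eq_in_mean n f g :
  (forall s, size s = n -> f s = g s) -> mean n f = mean n g.
Proof.
elim: n f g => [|n IH] f g fg /=; first exact: fg.
by congr ((_ + _) / _); apply: IH => s sn; apply: fg; rewrite /= sn.
Qed.

Lemma eq_mean n f g : f =1 g -> mean n f = mean n g.
Proof. by move=> fg; apply: eq_in_mean => s _. Qed.

Lemma ler_mean n f g : (forall s, f s <= g s) -> mean n f <= mean n g.
Proof.
elim: n f g => [|n IH] f g fg /=; first exact: fg.
by rewrite ler_pM2r ?invr_gt0 // lerD // IH.
Qed.

Lemma mean_const n (c : R) : mean n (fun=> c) = c.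
Proof. by elim: n => //= n ->; field. Qed.

Lemma mean_lin n (a b : R) f g :
  mean n (fun s => a * f s + b * g s) = a * mean n f + b * mean n g.
Proof. by elim: n f g => //= n IH f g; rewrite !IH; field. Qed.

Lemma mean_scale n (a : R) f : mean n (fun s => a * f s) = a * mean n f.
Proof.
rewrite -[RHS]addr0 -(mul0r (mean n f)) -mean_lin.
by apply: eq_mean => s; rewrite mul0r addr0.
Qed.

Lemma meanD n f g : mean n (fun s => f s + g s) = mean n f + mean n g.
Proof.
rewrite -[mean n f]mul1r -[mean n g]mul1r -mean_lin.
by apply: eq_mean => s; rewrite !mul1r.
Qed.

Lemma mean_sum n (T : finType) (A : {pred T}) (F : T -> seq bool -> R) :
  mean n (fun s => \sum_(i in A) F i s) = \sum_(i in A) mean n (F i).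
Proof.
rewrite -big_enum /=.
transitivity (mean n (fun s => \sum_(i <- enum A) F i s)).
  by apply: eq_mean => s; rewrite big_enum.
elim: (enum _) => [|i r IH].
  by rewrite big_nil -[RHS](mean_const n); apply: eq_mean => s; rewrite big_nil.
by rewrite big_cons -IH -meanD; apply: eq_mean => s; rewrite big_cons.
Qed.

Lemma mean_ge0 n f : (forall s, 0 <= f s) -> 0 <= mean n f.
Proof. by move=> f0; rewrite -(mean_const n 0); apply: ler_mean. Qed.

Lemma mean_cauchy n f g :
  mean n (fun s => f s * g s) ^+ 2 <=
  mean n (fun s => f s ^+ 2) * mean n (fun s => g s ^+ 2).
Proof.
elim: n f g => [|n IH] f g /=; first by rewrite exprMn.
have := IH (fun s => f (true :: s)) (fun s => g (true :: s)).
have := IH (fun s => f (false :: s)) (fun s => g (false :: s)).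
have := mean_ge0 n (fun s => sqr_ge0 (f (true :: s))).
have := mean_ge0 n (fun s => sqr_ge0 (f (false :: s))).
have := mean_ge0 n (fun s => sqr_ge0 (g (true :: s))).
have := mean_ge0 n (fun s => sqr_ge0 (g (false :: s))).
set c2 := mean _ _; set c1 := mean _ _; set b2 := mean _ _; set b1 := mean _ _.
set a2 := mean _ _; set a1 := mean _ _.
move=> c20 c10 b20 b10 h2 h1.
(* Only the cross terms of the two half-cubes remain: multiplying the induction hypotheses gives
   [(a1 a2)^2 <= b1 c1 b2 c2], and AM-GM does the rest. *)
suff : a1 * a2 * 2 <= b1 * c2 + b2 * c1 by nra.
apply: (@le_trans _ _ `|a1 * a2 * 2|); first exact: ler_norm.
rewrite -ler_sqr ?nnegrE ?normr_ge0 //; last by rewrite addr_ge0 ?mulr_ge0.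
rewrite real_normK ?num_real //.
apply: (@le_trans _ _ (4 * (b1 * c1 * (b2 * c2)))).
  have := ler_pM (sqr_ge0 a1) (sqr_ge0 a2) h1 h2; nra.
have := sqr_ge0 (b1 * c2 - b2 * c1); nra.
Qed.

(** The coordinates of a uniform point are independent. *)
Lemma mean_prod n (F : 'I_n -> bool -> R) :
  mean n (fun s => \prod_(i < n) F i (nth false s i)) =
  \prod_(i < n) ((F i true + F i false) / 2).
Proof.
elim: n F => [|n IH] F /=; first by rewrite !big_ord0.
rewrite big_ord_recl -(IH (fun i => F (lift ord0 i))) mulrAC [in RHS]mulrDl.
by congr ((_ + _) / _); rewrite -mean_scale; apply: eq_mean => s;
  rewrite big_ord_recl.
Qed.

(* [deg_lt n D f]: on the cube of dimension [n], [f] is a polynomial of degree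
   less than [D]; the two parts are those of [f = h + x g] in the first
   coordinate [x] (with values 1 and -1). *)
Definition even_part f s := (f (true :: s) + f (false :: s)) / 2.
Definition odd_part f s := (f (true :: s) - f (false :: s)) / 2.

Fixpoint deg_lt n D f : Prop :=
  if n is n'.+1 then deg_lt n' D (even_part f) /\ deg_lt n' D.-1 (odd_part f)
  else D = 0%N -> f [::] = 0.

Lemma eq_deg_lt n D f g : f =1 g -> deg_lt n D f -> deg_lt n D g.
Proof.
elim: n D f g => [|n IH] D f g fg /=; first by rewrite fg.
by case=> h1 h2; split; [apply: IH h1 | apply: IH h2] => s;
  rewrite /even_part /odd_part !fg.
Qed.

Lemma deg_lt_lin n D (a b : R) f g :
  deg_lt n D f -> deg_lt n D g -> deg_lt n D (fun s => a * f s + b * g s).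
Proof.
elim: n D f g => [|n IH] D f g /=.
  by move=> h1 h2 D0; rewrite h1 ?h2 // !mulr0 addr0.
case=> f1 f2 [g1 g2]; split.
  by apply: eq_deg_lt (IH _ _ _ f1 g1) => s; rewrite /even_part; field.
by apply: eq_deg_lt (IH _ _ _ f2 g2) => s; rewrite /odd_part; field.
Qed.

Lemma deg_lt0 n D : deg_lt n D (fun=> 0).
Proof.
elim: n D => [|n IH] D //=; split; apply: eq_deg_lt (IH _) => s;
  by rewrite /even_part /odd_part ?subrr ?addr0 mul0r.
Qed.

Lemma deg_lt_const n D (c : R) : deg_lt n D.+1 (fun=> c).
Proof.
elim: n D => [|n IH] D //=; split.
  by apply: eq_deg_lt (IH _) => s; rewrite /even_part; field.
by apply: eq_deg_lt (deg_lt0 _ _) => s; rewrite /odd_part subrr mul0r.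
Qed.

Lemma deg_lt_sum n D (T : finType) (A : {pred T}) (F : T -> seq bool -> R) :
  (forall i, i \in A -> deg_lt n D (F i)) ->
  deg_lt n D (fun s => \sum_(i in A) F i s).
Proof.
move=> degF.
suff: deg_lt n D (fun s => \sum_(i <- enum A) F i s).
  by apply: eq_deg_lt => s; rewrite big_enum.
have : all (mem A) (enum A) by apply/allP => i; rewrite mem_enum.
elim: (enum A) => [|i r IH] /=.
  by move=> _; apply: eq_deg_lt (deg_lt0 _ _) => s; rewrite big_nil.
case/andP=> iA /IH degr.
apply: eq_deg_lt (deg_lt_lin 1 1 (degF i iA) degr) => s.
by rewrite big_cons !mul1r.
Qed.

(** A factor with equal values at both bits is constant and costs no degree; any other factor is
    affine in its coordinate. *)
Lemma deg_lt_prod n D (F : 'I_n -> bool -> R) :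
  (#|[set i | F i true != F i false]| < D)%N ->
  deg_lt n D (fun s => \prod_(i < n) F i (nth false s i)).
Proof.
elim: n D F => [|n IH] D F; first by case: D.
rewrite -sum1dep_card big_mkcond big_ord_recl -big_mkcond sum1dep_card => cD.
pose P s := \prod_(i < n) F (lift ord0 i) (nth false s i).
have cons_prod b s : \prod_(i < n.+1) F i (nth false (b :: s) i) = F ord0 b * P s.
  by rewrite big_ord_recl.
split.
  have degP : deg_lt n D P.
    by apply: (IH _ (fun i => F (lift ord0 i)));
      apply: leq_ltn_trans cD; rewrite leq_addl.
  apply: eq_deg_lt (deg_lt_lin ((F ord0 true + F ord0 false) / 2) 0 degP degP).
  by move=> s; rewrite /even_part !cons_prod; field.
case: (eqVneq (F ord0 true) (F ord0 false)) cD => [eqF|neF] cD.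
  apply: eq_deg_lt (deg_lt0 _ _) => s.
  by rewrite /odd_part !cons_prod eqF subrr mul0r.
have degP : deg_lt n D.-1 P.
  by apply: (IH _ (fun i => F (lift ord0 i))); move: cD; case: (D).
apply: eq_deg_lt (deg_lt_lin ((F ord0 true - F ord0 false) / 2) 0 degP degP).
by move=> s; rewrite /odd_part !cons_prod; field.
Qed.

(** As [0.-1] is [0], both parts vanish by induction; the values of [f] are their sum and
    difference. *)
Lemma deg_lt0_eq0 n f : deg_lt n 0 f -> forall s, size s = n -> f s = 0.
Proof.
elim: n f => [|n IH] f /=; first by move=> f0 [] // _; apply: f0.
case=> /IH f1 /IH f2 [|b s] //= [sn].
have := f1 s sn; have := f2 s sn; rewrite /even_part /odd_part.
by case: b; lra.
Qed.

(* Bonami's lemma: induction on the dimension, Cauchy-Schwarz being applied to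
   the only mixed term [6 E[g^2 h^2]] of [E[(h + x g)^4]]. *)
Lemma bonami n D f : deg_lt n D f ->
  9 * mean n (fun s => f s ^+ 4) <= 9 ^+ D * mean n (fun s => f s ^+ 2) ^+ 2.
Proof.
elim: n D f => [|n IH] D f.
  case: D => [|D] /= f0.
    by rewrite f0 // !expr0n /= ?expr0n !mulr0.
  rewrite -exprM [9 ^+ D.+1]exprS -mulrA ler_pM2l //.
  by rewrite ler_peMl ?exprn_even_ge0 // exprn_ege1 // ler1n.
case: D => [|D] degf.
  have f0 := deg_lt0_eq0 degf.
  have -> : mean n.+1 (fun s => f s ^+ 4) = 0.
    rewrite -[RHS](mean_const n.+1); apply: eq_in_mean => s sn.
    by rewrite f0 // expr0n.
  by rewrite mulr0 expr0 mul1r sqr_ge0.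
case: degf => degh degg; rewrite [D.+1.-1]/= in degg.
set h := even_part f in degh; set g := odd_part f in degg.
have [IHh IHg] := (IH _ _ degh, IH _ _ degg).
have fE s : f (true :: s) = h s + g s /\ f (false :: s) = h s - g s.
  by rewrite /h /g /even_part /odd_part; split; field.
(* Terms odd in the first coordinate average out. *)
have -> : mean n.+1 (fun s => f s ^+ 4) = mean n (fun s => h s ^+ 4) +
    6 * mean n (fun s => g s ^+ 2 * h s ^+ 2) + mean n (fun s => g s ^+ 4).
  rewrite -mean_scale -!meanD /= -meanD mulrC -mean_scale.
  by apply: eq_mean => s; case: (fE s) => -> ->; field.
have -> : mean n.+1 (fun s => f s ^+ 2) =
    mean n (fun s => h s ^+ 2) + mean n (fun s => g s ^+ 2).
  rewrite -!meanD /= -meanD mulrC -mean_scale.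
  by apply: eq_mean => s; case: (fE s) => -> ->; field.
have := mean_cauchy n (fun s => g s ^+ 2) (fun s => h s ^+ 2).
have sq_sq u : mean n (fun s => (u s ^+ 2) ^+ 2) = mean n (fun s => u s ^+ 4).
  by apply: eq_mean => s; rewrite -exprM.
rewrite !sq_sq.
have h2_ge0 := mean_ge0 n (fun s => sqr_ge0 (h s)).
have g2_ge0 := mean_ge0 n (fun s => sqr_ge0 (g s)).
have h4_ge0 : 0 <= mean n (fun s => h s ^+ 4).
  by apply: mean_ge0 => s; rewrite exprn_even_ge0.
have g4_ge0 : 0 <= mean n (fun s => g s ^+ 4).
  by apply: mean_ge0 => s; rewrite exprn_even_ge0.
have p_ge0 : 0 <= 9 ^+ D :> R by rewrite exprn_ge0.
move: IHh IHg h2_ge0 g2_ge0 h4_ge0 g4_ge0 p_ge0; rewrite exprS.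
move: (mean n (fun s => h s ^+ 4)) (mean n (fun s => h s ^+ 2)).
move: (mean n (fun s => g s ^+ 4)) (mean n (fun s => g s ^+ 2)).
move: (mean n (fun s => g s ^+ 2 * h s ^+ 2)) (9 ^+ D).
move=> gh p g4 g2 h4 h2 IHh IHg h2_ge0 g2_ge0 h4_ge0 g4_ge0 p_ge0 cs.
(* The degree bound of the odd part is lower by one, so [9 g4 <= p g2^2]. This 9 turns
   Cauchy-Schwarz into [3 gh <= p g2 h2], and [6 gh] fits into the mixed term of [p (h2 + g2)^2]. *)
have ph : h4 <= p * h2 ^+ 2 by nra.
have hg : g4 * h4 <= (p * g2 ^+ 2 / 9) * (p * h2 ^+ 2).
  by apply: ler_pM => //; rewrite ler_pdivlMr // mulrC.
have gh_le : 3 * gh <= p * g2 * h2.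
  apply: le_trans (ler_norm _) _.
  rewrite -ler_sqr ?nnegrE ?mulr_ge0 // real_normK ?num_real //.
  rewrite exprMn (_ : (p * g2 * h2) ^+ 2 = 9 * (p * g2 ^+ 2 / 9 * (p * h2 ^+ 2)));
    last by field.
  have : gh ^+ 2 <= p * g2 ^+ 2 / 9 * (p * h2 ^+ 2) by apply: le_trans hg.
  lra.
have : p * g2 ^+ 2 >= 0 by rewrite mulr_ge0 ?sqr_ge0.
nra.
Qed.

(* A centred variable bounded above by [K] has [E|X| <= 2 K]; a small fourth
   moment then forces a small second moment.  The pointwise inequality is
   [l^2 x^2 <= l^3 |x| + x^4], used with [l = E[X^2] / (4 K)]. *)
Lemma second_moment_le n f (b K : R) : 0 <= b -> 0 < K ->
  (forall s, f s <= K) -> mean n f = 0 ->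
  mean n (fun s => f s ^+ 4) <= b * mean n (fun s => f s ^+ 2) ^+ 2 ->
  mean n (fun s => f s ^+ 2) <= 32 * b * K ^+ 2.
Proof.
move=> b_ge0 K_gt0 fK f0 f4.
have [S0|S_gt0] := leP (mean n (fun s => f s ^+ 2)) 0.
  by apply: le_trans S0 _; rewrite !mulr_ge0 ?sqr_ge0 // ltW.
pose l := mean n (fun s => f s ^+ 2) / (4 * K).
have l_gt0 : 0 < l by rewrite divr_gt0 ?mulr_gt0.
have pw s : l ^+ 2 * f s ^+ 2 + l ^+ 3 * f s <= 2 * K * l ^+ 3 + f s ^+ 4.
  (* Pointwise form of [E|X| <= 2 K]: an affine bound whose linear term has mean zero. *)
  have yK : `|f s| <= 2 * K - f s by rewrite ler_norml; have := fK s; lra.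
  have : l ^+ 2 * `|f s| ^+ 2 <= l ^+ 3 * `|f s| + `|f s| ^+ 4.
    have [yl|ly] := leP `|f s| l.
      have := mulr_ge0 (sqr_ge0 l) (mulr_ge0 (normr_ge0 (f s)) (_ : 0 <= l - `|f s|)).
      rewrite subr_ge0 => /(_ yl); have := exprn_ge0 4 (normr_ge0 (f s)); nra.
    have : l ^+ 2 <= `|f s| ^+ 2 by rewrite ler_sqr ?nnegrE // ltW.
    have : 0 <= l ^+ 3 * `|f s| by rewrite mulr_ge0 // exprn_ge0 // ltW.
    have := sqr_ge0 `|f s|; nra.
  rewrite real_normK ?num_real // [`|f s| ^+ 4](exprM _ 2 2) real_normK ?num_real //.
  rewrite -exprM.
  have := ler_wpM2l (exprn_ge0 3 (ltW l_gt0)) yK; lra.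
have := ler_mean n pw.
rewrite mean_lin f0 mulr0 addr0 meanD mean_const.
move: f4 S_gt0; rewrite /l.
move: (mean n (fun s => f s ^+ 4)) (mean n (fun s => f s ^+ 2)).
move=> F S f4 S_gt0 le1.
have SE : S = 4 * K * (S / (4 * K)) by field; rewrite gt_eqF.
have q_gt0 : 0 < S / (4 * K) by rewrite divr_gt0 ?mulr_gt0.
move: SE q_gt0 le1 f4; move: (S / (4 * K)) => q -> q_gt0 le1 f4.
(* Here [q] is [l] and [E[X^2] = 4 K q]; the averaged inequality yields [2 K q^3 <= E[X^4] <= 16 b
   K^2 q^2]. *)
suff : q <= 8 * b * K by move=> /(ler_wpM2l (ltW K_gt0)); lra.
have p_gt0 : 0 < 2 * K * q ^+ 2 by rewrite !mulr_gt0 ?exprn_gt0.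
rewrite -(ler_pM2l p_gt0); lra.
Qed.

End Cube.

(** * Second moment of the number of satisfied clauses *)

Section Clauses.
Variable n : nat.
Implicit Types (Y Z : clause n) (i : 'I_n) (s : seq bool).

Definition consistent Y := forall p, p \in Y -> neg_lit p \notin Y.

(** A consistent clause as a partial sign function; its falsification becomes a product over all
    coordinates, to which [mean_prod] and [deg_lt_prod] apply. *)
Definition polarity Y i : option bool :=
  if (i, true) \in Y then Some true
  else if (i, false) \in Y then Some false else None.

Lemma polarityE Y i a : consistent Y -> (polarity Y i == Some a) = ((i, a) \in Y).
Proof.
rewrite /polarity => cY; case: ifPn => iT.
  by case: a; rewrite ?iT // (negbTE (cY _ iT)).
by case: ifP => iF; case: a; rewrite ?iF ?(negbTE iT).
Qed.

Lemma card_polarity Y : consistent Y -> #|[set i | polarity Y i]| = #|Y|.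
Proof.
move=> cY; rewrite -[RHS](card_in_imset (f := fst)).
  apply: eq_card => i; rewrite inE; apply/idP/imsetP => [|[[j a] jY /= ->]].
    case E: (polarity Y i) => [a|] // _; exists (i, a) => //.
    by rewrite -polarityE // E.
  by move: jY; rewrite -polarityE // => /eqP ->.
move=> [i a] [j b] iY jY /= ij; move: jY iY; rewrite -ij -!polarityE //.
by move=> /eqP -> /eqP [->].
Qed.

Definition assignment_of s : assignment n := [ffun i : 'I_n => nth false s i].

Definition lit_unsat (o : option bool) (b : bool) : rat :=
  if o is Some a then (a != b)%:R else 1.

Definition clause_unsat Y s : rat :=
  \prod_(i < n) lit_unsat (polarity Y i) (nth false s i).

Lemma clause_unsatE Y s : consistent Y ->
  clause_unsat Y s = (~~ sat_clause (assignment_of s) Y)%:R.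
Proof.
move=> cY; rewrite /sat_clause; case: existsP => [[[i a]]|nsat] /=.
  rewrite -polarityE // ffunE => /andP[/eqP iY /eqP si].
  by rewrite /clause_unsat (bigD1 i) //= iY si /= eqxx mul0r.
apply: big1 => i _; case E: (polarity Y i) => [a|] //=.
case: eqP => // si; case: nsat; exists (i, a).
by rewrite -polarityE // E ffunE /= -si !eqxx.
Qed.

Lemma prod_polarity Y (c : rat) : consistent Y ->
  \prod_(i < n) (if polarity Y i then c else 1) = c ^+ #|Y|.
Proof.
move=> cY; rewrite -big_mkcond prodr_const -card_polarity //.
by congr (_ ^+ _); apply: eq_card => i; rewrite inE.
Qed.

Lemma mean_clause_unsat Y : consistent Y ->
  mean n (clause_unsat Y) = 2^-1 ^+ #|Y|.
Proof.
move=> cY; rewrite (mean_prod (fun i b => lit_unsat (polarity Y i) b)).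
rewrite -prod_polarity //; apply: eq_bigr => i _.
by case: (polarity Y i) => [[]|] /=; rewrite ?addr0 ?add0r ?mul1r.
Qed.

(* The factor by which the events "Y is falsified" and "Z is falsified" fail
   to be independent. *)
Definition lit_corr (o o' : option bool) : rat :=
  if o is Some a then if o' is Some b then (a == b)%:R * 2 else 1 else 1.

Definition corr Y Z : rat := \prod_(i < n) lit_corr (polarity Y i) (polarity Z i).

(** Coordinate by coordinate: a shared literal is false with probability 1/2 instead of the
    independent 1/4, whence the factor 2; opposite literals are never both false, whence 0. *)
Lemma mean_clause_unsatM Y Z : consistent Y -> consistent Z ->
  mean n (fun s => clause_unsat Y s * clause_unsat Z s) =
  2^-1 ^+ #|Y| * 2^-1 ^+ #|Z| * corr Y Z.
Proof.
move=> cY cZ.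
pose F i b := lit_unsat (polarity Y i) b * lit_unsat (polarity Z i) b.
transitivity (mean n (fun s => \prod_(i < n) F i (nth false s i))).
  by apply: eq_mean => s; rewrite big_split.
rewrite mean_prod -!prod_polarity // -!big_split /=; apply: eq_bigr => i _.
rewrite /F; case: (polarity Y i) => [[]|]; case: (polarity Z i) => [[]|];
  by rewrite /= ?eqxx /=; field.
Qed.

Lemma lit_corr_ge0 o o' : 0 <= lit_corr o o'.
Proof. by case: o => [[]|]; case: o' => [[]|]. Qed.

Lemma corr_ge0 Y Z : 0 <= corr Y Z.
Proof. by apply: prodr_ge0 => i _; apply: lit_corr_ge0. Qed.

Lemma lit_corr_ge1 Y Z i : consistent Y -> consistent Z ->
  ~~ has_conflict Y Z -> 1 <= lit_corr (polarity Y i) (polarity Z i).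
Proof.
move=> cY cZ /existsPn nc.
case EY: (polarity Y i) => [a|] //; case EZ: (polarity Z i) => [b|] //.
have := nc (i, a); rewrite -!polarityE // EY EZ /= eqxx /=.
by case: a {EY}; case: b {EZ}.
Qed.

Lemma corr_ge1 Y Z : consistent Y -> consistent Z -> ~~ has_conflict Y Z ->
  1 <= corr Y Z.
Proof.
move=> cY cZ nc; rewrite /corr; apply: (big_ind (>= 1)) => // [x y x1 y1|i _].
  by rewrite mulr_ege1.
exact: lit_corr_ge1.
Qed.

Lemma corr_overlap Y Z : consistent Y -> consistent Z -> has_overlap Y Z ->
  2 <= corr Y Z.
Proof.
move=> cY cZ /andP[/existsP[[i a] /andP[]] + + nc].
rewrite -!polarityE // => /eqP EY /eqP EZ.
rewrite /corr (bigD1 i) //= EY EZ /= eqxx mul1r -[leLHS]mulr1 ler_pM2l //.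
apply: (big_ind (>= 1)) => // [x y x1 y1|j _]; first by rewrite mulr_ege1.
exact: lit_corr_ge1.
Qed.

Lemma corr_id Y : consistent Y -> corr Y Y = 2 ^+ #|Y|.
Proof.
move=> cY; rewrite -prod_polarity //; apply: eq_bigr => i _.
by case: (polarity Y i) => //= a; rewrite eqxx mul1r.
Qed.

(** Summed over all ordered pairs of clauses of size [r], the left side becomes
    [(2^r - 1) m - cn(C)]. *)
Lemma corr_ge r Y Z : consistent Y -> consistent Z -> #|Y| = r ->
  (Y == Z)%:R * (2 ^+ r - 1) - ((Y != Z) && has_conflict Y Z)%:R +
    ((Y != Z) && has_overlap Y Z)%:R <= corr Y Z - 1.
Proof.
move=> cY cZ Yr; case: eqVneq => [<-|_] /=.
  by rewrite mul1r subr0 addr0 corr_id // Yr.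
rewrite mul0r add0r; case: (boolP (has_overlap Y Z)) => [ov|_].
  have := corr_overlap cY cZ ov; case/andP: ov => _ /negbTE -> /=; lra.
case: (boolP (has_conflict Y Z)) => [_|nc] /=.
  by have := corr_ge0 Y Z; lra.
by have := corr_ge1 cY cZ nc; lra.
Qed.

(** * Moments of the excess of a whole formula *)

Section Formula.
Variables (r : nat) (C : {set clause n}).
Hypothesis exactC : exact_cnf r C.

Let m : rat := #|C|%:R.

Definition excess s : rat := \sum_(Y in C) (2^-1 ^+ r - clause_unsat Y s).

Lemma excessE s :
  excess s = (num_sat (assignment_of s) C)%:R - (1 - 2^-1 ^+ r) * m.
Proof.
have -> : (num_sat (assignment_of s) C)%:R =
    \sum_(Y in C) (sat_clause (assignment_of s) Y)%:R :> rat.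
  rewrite /num_sat -sum1_card natr_sum.
  rewrite (eq_bigl (fun Y => (Y \in C) && sat_clause (assignment_of s) Y)).
    by rewrite big_mkcondr; apply: eq_bigr => Y _; case: sat_clause.
  by move=> Y; rewrite inE.
rewrite /m -sum1_card natr_sum mulr_sumr -sumrB.
apply: eq_bigr => Y /exactC[_ cY]; rewrite clause_unsatE //.
by case: sat_clause => /=; lra.
Qed.

Lemma mean_excess : mean n excess = 0.
Proof.
rewrite mean_sum big1 // => Y /exactC[Yr cY].
transitivity (mean n (fun s => 2^-1 ^+ r * 1 + -1 * clause_unsat Y s)).
  by apply: eq_mean => s; rewrite mulr1 mulN1r.
by rewrite mean_lin mean_const mean_clause_unsat // Yr mulr1 mulN1r subrr.
Qed.

Lemma deg_excess : deg_lt n r.+1 excess.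
Proof.
apply: deg_lt_sum => Y /exactC[Yr cY].
have degY : deg_lt n r.+1 (clause_unsat Y).
  apply: (deg_lt_prod (F := fun i b => lit_unsat (polarity Y i) b)).
  rewrite ltnS -Yr -(card_polarity cY) subset_leq_card //.
  apply/subsetP => i; rewrite !inE; by case: (polarity Y i) => //=; rewrite eqxx.
apply: eq_deg_lt (deg_lt_lin 1 (-1) (deg_lt_const n r (2^-1 ^+ r)) degY) => s.
by rewrite mul1r mulN1r.
Qed.

(** The covariance of the falsification indicators of [Y] and [Z] is [4^-r (corr Y Z - 1)]. *)
Lemma mean_excess_sq :
  mean n (fun s => excess s ^+ 2) =
  4^-1 ^+ r * \sum_(Y in C) \sum_(Z in C) (corr Y Z - 1).
Proof.
transitivity (mean n (fun s => \sum_(Y in C) \sum_(Z in C)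
    (2^-1 ^+ r - clause_unsat Y s) * (2^-1 ^+ r - clause_unsat Z s))).
  apply: eq_mean => s; rewrite expr2 {1}/excess mulr_suml.
  by apply: eq_bigr => Y _; rewrite mulr_sumr.
rewrite mean_sum mulr_sumr; apply: eq_bigr => Y /exactC[Yr cY].
rewrite mean_sum mulr_sumr; apply: eq_bigr => Z /exactC[Zr cZ].
transitivity (mean n (fun s => 1 * (clause_unsat Y s * clause_unsat Z s) +
  - 2^-1 ^+ r * (1 * clause_unsat Y s + 1 * clause_unsat Z s)
  + 2^-1 ^+ r * 2^-1 ^+ r)).
  by apply: eq_mean => s; ring.
rewrite meanD mean_const !mean_lin mean_clause_unsatM // !mean_clause_unsat //.
rewrite Yr Zr (_ : 4^-1 ^+ r = 2^-1 ^+ r * 2^-1 ^+ r :> rat); first by ring.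
by rewrite -exprMn -invfM -natrM.
Qed.

Lemma sum_pairs (P : clause n -> clause n -> bool) :
  \sum_(Y in C) \sum_(Z in C) (P Y Z)%:R =
  #|[set YZ in setX C C | P YZ.1 YZ.2]|%:R :> rat.
Proof.
rewrite pair_big /= -sum1_card natr_sum.
rewrite [RHS](eq_bigl (fun YZ => (YZ.1 \in C) && (YZ.2 \in C) && P YZ.1 YZ.2)).
  by rewrite [RHS]big_mkcondr; apply: eq_bigr => -[Y Z] _ /=; case: (P Y Z).
by case=> Y Z; rewrite !inE.
Qed.

Lemma mean_excess_sq_ge :
  conflict_number C <= (2 ^+ r - 2) * #|C|%:Z ->
  m <= 4 ^+ r * mean n (fun s => excess s ^+ 2).
Proof.
move=> low; rewrite mean_excess_sq mulrA -exprMn divff // expr1n mul1r.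
have {}low : (conflict_number C)%:~R <= (2 ^+ r - 2) * m :> rat.
  have -> : (2 ^+ r - 2) * m = ((2 ^+ r - 2) * #|C|%:Z)%:~R.
    by rewrite rmorphM rmorphB rmorphXn.
  by rewrite ler_int.
rewrite /conflict_number rmorphB /= in low.
have : \sum_(Y in C) \sum_(Z in C) ((Y == Z)%:R * (2 ^+ r - 1) -
    ((Y != Z) && has_conflict Y Z)%:R + ((Y != Z) && has_overlap Y Z)%:R)
    <= \sum_(Y in C) \sum_(Z in C) (corr Y Z - 1).
  apply: ler_sum => Y /exactC[Yr cY]; apply: ler_sum => Z /exactC[_ cZ].
  exact: corr_ge.
apply: le_trans.
under eq_bigr => Y _ do rewrite big_split sumrB -mulr_suml /=.
rewrite big_split sumrB -mulr_suml /=.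
have -> : \sum_(Y in C) \sum_(Z in C) (Y == Z)%:R = m.
  rewrite /m -sum1_card natr_sum; apply: eq_bigr => Y YC.
  rewrite (bigD1 Y) //= eqxx big1 ?addr0 // => Z /andP[_].
  by rewrite eq_sym => /negbTE ->.
rewrite (sum_pairs (fun Y Z => (Y != Z) && has_conflict Y Z)).
rewrite (sum_pairs (fun Y Z => (Y != Z) && has_overlap Y Z)); lra.
Qed.

Lemma num_clauses_le (K : rat) : 0 < K ->
  conflict_number C <= (2 ^+ r - 2) * #|C|%:Z ->
  (forall t, (num_sat t C)%:R <= (1 - 2^-1 ^+ r) * m + K) ->
  m <= 32 * 36 ^+ r * K ^+ 2.
Proof.
move=> K_gt0 /mean_excess_sq_ge le_m satK.
have bon : mean n (fun s => excess s ^+ 4) <=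
    9 ^+ r * mean n (fun s => excess s ^+ 2) ^+ 2.
  (* [deg_lt] is a strict bound, so the exponent is [r.+1]; its extra factor 9 cancels the one on
     the left. *)
  by have := bonami deg_excess; rewrite [9 ^+ r.+1]exprS -mulrA ler_pM2l.
have le_K s : excess s <= K.
  by rewrite excessE; have := satK (assignment_of s); lra.
have b_ge0 : 0 <= 9 ^+ r :> rat by rewrite exprn_ge0.
have := second_moment_le b_ge0 K_gt0 le_K mean_excess bon.
move=> /(ler_wpM2l (exprn_ge0 r (ler0n _ 4))); rewrite /= => le2.
apply: le_trans le_m (le_trans le2 _).
have -> : 36 = 4 * 9 :> rat by rewrite -natrM.
rewrite exprMn le_eqVlt; apply/orP; left.
by apply/eqP; ring.
Qed.

End Formula.
End Clauses.

Local Open Scope nat_scope.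

(** * The Turing machine *)

Section Zipper.
Variable T : Type.
Implicit Types (x : option T) (r : seq (option T)).

(* [(l, r)] is the tape [rev l ++ r] followed by blanks, with the head on the
   first cell of [r]; trailing blanks of [r] are not recorded. *)
Definition zipper := (seq (option T) * seq (option T))%type.

(** A blank in front of an empty list is dropped, so that runs can be stated as equalities of
    zippers. *)
Definition push x r :=
  if x is Some _ then x :: r else if r is [::] then [::] else x :: r.

Definition zread (z : zipper) : option T := head None z.2.

Definition zact (z : zipper) (a : option T * move) : zipper :=
  let: (l, r) := z in
  match a.2 with
  | MoveL => if l is y :: l' then (l', push y (push a.1 (behead r)))
             else ([::], push a.1 (behead r))
  | MoveN => (l, push a.1 (behead r))
  | MoveR => (a.1 :: l, behead r)
  end.

Definition zrep (h : nat) (f : nat -> option T) (z : zipper) : Prop :=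
  h = size z.1 /\ forall p, f p = nth None (catrev z.1 z.2) p.

Lemma nth_push x r p : nth None (push x r) p = nth None (x :: r) p.
Proof. by case: x r => [a|] [|y r] //; case: p => [|p] //=; rewrite nth_nil. Qed.

Lemma zrep_read h f z : zrep h f z -> f h = zread z.
Proof.
case: z => l r [-> ->]; rewrite catrevE nth_cat size_rev ltnn subnn.
by rewrite nth0.
Qed.

Lemma zrep_act h f z a : zrep h f z ->
  zrep (move_head a.2 h) (fun p => if p == h then a.1 else f p) (zact z a).
Proof.
case: z => l r [/= -> fE]; case: a => x d /=.
have writeE p : (if p == size l then x else f p) =
    nth None (rev l ++ x :: behead r) p.
  rewrite fE catrevE !nth_cat size_rev.
  case: ltngtP => // [lt|->]; last by rewrite subnn.
  rewrite -[p - size l]prednK ?subn_gt0 //= nth_behead.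
  by rewrite prednK ?subn_gt0.
case: d => /=.
- case: l writeE {fE} => [|y l] writeE; split=> // p; rewrite writeE.
    by rewrite /= nth_push.
  rewrite catrevE /= rev_cons cat_rcons !nth_cat; case: ifP => // _.
  rewrite nth_push; case: (p - _) => [|q] //=; by rewrite nth_push.
- split=> // p; rewrite writeE catrevE !nth_cat; case: ifP => // _.
  by rewrite nth_push.
- by split=> // p; rewrite writeE catrevE rev_cons cat_rcons.
Qed.

End Zipper.

(** * The counting machine and its simulation on zippers *)

Inductive phase :=
  Init | ReadN | ReadJ | ReadJ2 | Pad | Rewind | Scan | Incr | Erase | Write | Halt.

Definition phases :=
  [:: Init; ReadN; ReadJ; ReadJ2; Pad; Rewind; Scan; Incr; Erase; Write; Halt].

Definition phase_index (p : phase) : nat :=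
  match p with
  | Init => 0 | ReadN => 1 | ReadJ => 2 | ReadJ2 => 3 | Pad => 4 | Rewind => 5
  | Scan => 6 | Incr => 7 | Erase => 8 | Write => 9 | Halt => 10
  end.

Lemma phase_indexK : cancel phase_index (nth Init phases).
Proof. by case. Qed.

HB.instance Definition _ := Countable.copy phase (can_type phase_indexK).

Lemma phases_enum : Finite.axiom phases.
Proof. by case. Qed.

HB.instance Definition _ := isFinite.Build phase phases_enum.

Section Machine.
(* Tape 0 holds the input, its cell 0 being overwritten by [mark]; tape 2 holds
   the copy of the input read so far; tape 1 holds [mark] and then a binary
   counter of clauses, least significant bit first, with two bits per bit of the
   parameter and [c0] more.  When the counter overflows, [Erase] clears tape 2
   (the mark on tape 0 detects its left end) and [Write] puts [u] there. *)
Variables (c0 : nat) (u : seq symbol).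

(** The second component is a loop counter, running to [c0] in [Pad] and to [size u] in [Write]. *)
Definition state : finType := (phase * 'I_(c0 + size u).+1)%type.
Definition wcell := option (symbol + option bool).

Definition mark : wcell := Some (inr None).
Definition cbit (b : bool) : wcell := Some (inr (Some b)).
Definition csym (x : symbol) : wcell := Some (inl x).

Definition action := (wcell * move)%type.

(** [Init] saves the overwritten first symbol on tape 2. [ReadJ] and [ReadJ2] each append a zero to
    the counter, hence two steps per bit. [Incr] propagates the carry and meets a blank exactly on
    overflow. *)
Definition rule (q : state) (a b c : wcell) : state * action * action * action :=
  let go p k := (p, inord k) : state in
  let stay p k := (go p k, (a, MoveN), (b, MoveN), (c, MoveN)) in
  match q.1 with
  | Init => (go (if a == csym sep then ReadJ else ReadN) 0,
             (mark, MoveR), (mark, MoveR), (a, MoveR))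
  | ReadN => (go (if a == csym sep then ReadJ else ReadN) 0,
              (a, MoveR), (b, MoveN), (a, MoveR))
  | ReadJ => if a == csym sep
             then (go Pad 0, (a, MoveR), (b, MoveN), (a, MoveR))
             else (go ReadJ2 0, (a, MoveN), (cbit false, MoveR), (c, MoveN))
  | ReadJ2 => (go ReadJ 0, (a, MoveR), (cbit false, MoveR), (a, MoveR))
  | Pad => if q.2 < c0
           then (go Pad q.2.+1, (a, MoveN), (cbit false, MoveR), (c, MoveN))
           else stay Rewind 0
  | Rewind => if b == mark then stay Scan 0
              else (go Rewind 0, (a, MoveN), (b, MoveL), (c, MoveN))
  | Scan => if a == None then stay Halt 0
            else if a == csym sep
            then (go Incr 0, (a, MoveR), (b, MoveR), (a, MoveR))
            else (go Scan 0, (a, MoveR), (b, MoveN), (a, MoveR))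
  | Incr => if b == cbit true
            then (go Incr 0, (a, MoveN), (cbit false, MoveR), (c, MoveN))
            else if b == cbit false
            then (go Rewind 0, (a, MoveN), (cbit true, MoveN), (c, MoveN))
            else stay Erase 0
  | Erase => if a == mark then (go Write 0, (a, MoveN), (b, MoveN), (None, MoveN))
             else (go Erase 0, (a, MoveL), (b, MoveN), (None, MoveL))
  | Write => if q.2 < size u
             then (go Write q.2.+1, (a, MoveN), (b, MoveN),
                   (csym (nth sep u q.2), MoveR))
             else stay Halt 0
  | Halt => stay Halt 0
  end.

Definition tape1 : 'I_3 := Ordinal (isT : 1 < 3).

Definition machine : tm symbol :=
  @TM symbol state (option bool) 2 (Init, ord0) (fun q => q.1 == Halt)
    (fun q f =>
       let: (q', x0, x1, x2) := rule q (f ord0) (f tape1) (f ord_max) in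
       (q', [ffun i => if i == ord0 then x0
                       else if i == ord_max then x2 else x1])).

Definition zipper3 := (state * zipper (symbol + option bool) *
  zipper (symbol + option bool) * zipper (symbol + option bool))%type.

(** On zippers a run is an equality provable by computation, whereas tapes as functions are compared
    pointwise. *)
Definition zstep (x : zipper3) : zipper3 :=
  let: (q, t0, t1, t2) := x in
  if q.1 == Halt then x else
  let: (q', a0, a1, a2) := rule q (zread t0) (zread t1) (zread t2) in
  (q', zact t0 a0, zact t1 a1, zact t2 a2).

Definition crep (c : config machine) (x : zipper3) : Prop :=
  let: (q, t0, t1, t2) := x in
  [/\ cf_state c = q,
      zrep (cf_head c ord0) (cf_tape c ord0) t0,
      zrep (cf_head c tape1) (cf_tape c tape1) t1 &
      zrep (cf_head c ord_max) (cf_tape c ord_max) t2].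

Lemma crep_step c x : crep c x -> crep (tm_step c) (zstep x).
Proof.
case: x => [[[q t0] t1] t2] [Eq r0 r1 r2]; rewrite /tm_step /zstep Eq.
rewrite [tm_halt _]/=; case: ifP => [_|_]; first by split.
rewrite /= !ffunE (zrep_read r0) (zrep_read r1) (zrep_read r2).
case: (rule q _ _ _) => [[[q' a0] a1] a2] /=.
by rewrite /crep /= !ffunE /=; split => //; apply: zrep_act.
Qed.

Lemma crep_iter t c x : crep c x ->
  crep (iter t (@tm_step _ machine) c) (iter t zstep x).
Proof. by move=> cx; elim: t => //= t /crep_step. Qed.

Definition tword (w : seq symbol) : seq wcell := [seq csym x | x <- w].

Lemma nth_tword w p : nth None (tword w) p = tm_word machine w p.
Proof. by rewrite /tm_word onthE -map_comp. Qed.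

Lemma crep_start w :
  crep (tm_start machine w) ((Init, ord0), ([::], tword w), ([::], [::]), ([::], [::])).
Proof.
split=> //=; split=> // p; rewrite /= ?nth_nil //.
by rewrite nth_tword.
Qed.

Lemma tm_outputs_zstep w w' t q t0 t1 :
  iter t zstep ((Init, ord0), ([::], tword w), ([::], [::]), ([::], [::])) =
    ((Halt, q), t0, t1, (rev (tword w'), [::])) ->
  tm_outputs_in machine w t w'.
Proof.
move=> E; have := crep_iter t (crep_start w); rewrite E.
case=> Eq _ _ [_ tapeE]; split; first by rewrite Eq.
by move=> p; rewrite tapeE /= catrevE revK cats0 nth_tword.
Qed.

(** * Runs of the single phases *)

Definition bits (s : seq bool) : seq wcell := [seq cbit b | b <- s].

Definition at_phase (p : phase) (k : nat) : state := (p, inord k).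

(** The mark is reached after [size p + 1] moves; one more step changes the phase. *)
Lemma rewind_run l0 z l2 p q :
  iter (size p).+2 zstep
    (at_phase Rewind 0, (l0, tword z), (rcons (bits p) mark, bits q), (l2, [::])) =
  (at_phase Scan 0, (l0, tword z), ([::], mark :: bits (catrev p q)), (l2, [::])).
Proof.
elim: p q => [|b p IH] q; rewrite iterSr.
  by case: q z => [|b q] [|x z].
rewrite -/(catrev _ _) [catrev _ _]/= -(IH (b :: q)); congr (iter _ _ _).
by case: q z {IH} => [|c q] [|x z].
Qed.

Fixpoint incr_bits (s : seq bool) : option (seq bool) :=
  match s with
  | [::] => None
  | false :: s' => Some (true :: s')
  | true :: s' => omap (cons false) (incr_bits s')
  end.

Fixpoint bits_val (s : seq bool) : nat :=
  if s is b :: s' then b + (bits_val s').*2 else 0.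

Lemma incr_bits_some s s' : incr_bits s = Some s' ->
  size s' = size s /\ bits_val s' = (bits_val s).+1.
Proof.
elim: s s' => [|[] s IH] s' //=; last by case=> <-.
case E: (incr_bits s) => [s1|] //= [<-] /=.
by have [-> ->] := IH _ E; split=> //; lia.
Qed.

(** Only the all-ones word overflows. *)
Lemma incr_bits_none s : incr_bits s = None -> (bits_val s).+1 = 2 ^ size s.
Proof.
elim: s => [|[] s IH] //=; case E: (incr_bits s) => [|] //= _.
by rewrite expnS -IH //; lia.
Qed.

Lemma bits_val_lt s : bits_val s < 2 ^ size s.
Proof. by elim: s => [|b s IH] //=; rewrite expnS; case: b; lia. Qed.

(** Where the carry stops depends on the bits, so only the whole counter [catrev p1 q1] is
    specified; the size bounds serve the time estimate. *)
Lemma incr_run_some l0 z l2 p q q' : incr_bits q = Some q' ->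
  exists t p1 q1, [/\ t <= (size q).+1, size p1 <= size p + size q,
    catrev p1 q1 = catrev p q' &
    iter t zstep
      (at_phase Incr 0, (l0, tword z), (rcons (bits p) mark, bits q), (l2, [::])) =
    (at_phase Rewind 0, (l0, tword z), (rcons (bits p1) mark, bits q1), (l2, [::]))].
Proof.
elim: q p q' => [|[] q IH] p q' //=; last first.
  case=> <-; exists 1, p, (true :: q); split=> //; first by rewrite leq_addr.
  by case: (z).
case E: (incr_bits q) => [s|] //= [<-].
have [t [p1 [q1 [lt1 lp1 ct it]]]] := IH (false :: p) _ E.
exists t.+1, p1, q1; split=> //; first by rewrite addnS -addSn.
rewrite iterSr -it; congr (iter _ _ _); by case: (z).
Qed.

Lemma incr_run_none l0 z l2 p q : incr_bits q = None ->
  exists t1, iter (size q).+1 zstep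
      (at_phase Incr 0, (l0, tword z), (rcons (bits p) mark, bits q), (l2, [::])) =
    (at_phase Erase 0, (l0, tword z), t1, (l2, [::])).
Proof.
elim: q p => [|[] q IH] p //; first by move=> _; eexists; case: (z).
rewrite [incr_bits _]/=; case E: (incr_bits q) => [s|] // _.
have [t1 it] := IH (false :: p) E.
exists t1; rewrite iterSr -it; congr (iter _ _ _); by case: (z).
Qed.

Lemma csym_eq x y : (csym x == csym y) = (x == y).
Proof. by apply: inj_eq => a b [->]. Qed.

Lemma readN_run l0 t1 l2 a z : sep \notin a ->
  iter (size a).+1 zstep
    (at_phase ReadN 0, (l0, tword (a ++ sep :: z)), (t1, [::]), (l2, [::])) =
  (at_phase ReadJ 0, (csym sep :: catrev (tword a) l0, tword z), (t1, [::]),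
    (csym sep :: catrev (tword a) l2, [::])).
Proof.
elim: a l0 l2 => [|x a IH] l0 l2; first by [].
rewrite inE negb_or eq_sym => /andP[xs /IH {}IH].
rewrite iterSr -[RHS]IH; congr (iter _ _ _).
by rewrite /zstep /rule /= csym_eq (negbTE xs).
Qed.

Lemma readJ_run l0 k l2 b z : sep \notin b ->
  iter (size b).*2.+1 zstep
    (at_phase ReadJ 0, (l0, tword (b ++ sep :: z)),
      (rcons (bits (nseq k false)) mark, [::]), (l2, [::])) =
  (at_phase Pad 0, (csym sep :: catrev (tword b) l0, tword z),
    (rcons (bits (nseq (k + (size b).*2) false)) mark, [::]),
    (csym sep :: catrev (tword b) l2, [::])).
Proof.
elim: b l0 l2 k => [|x b IH] l0 l2 k; first by rewrite addn0.
rewrite inE negb_or eq_sym => /andP[xs /IH {}IH].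
rewrite doubleS 2!iterSr -!addSnnS -[RHS]IH; congr (iter _ _ _).
by rewrite {2}/zstep /rule /= csym_eq (negbTE xs).
Qed.

Lemma pad_run l0 k l2 z i : i <= c0 ->
  iter (c0 - i).+1 zstep
    (at_phase Pad i, (l0, tword z),
      (rcons (bits (nseq k false)) mark, [::]), (l2, [::])) =
  (at_phase Rewind 0, (l0, tword z),
    (rcons (bits (nseq (k + (c0 - i)) false)) mark, [::]), (l2, [::])).
Proof.
move Ej: (c0 - i) => j; elim: j i k Ej => [|j IH] i k Ej ic.
  have -> : i = c0 by lia.
  rewrite addn0 /= /at_phase /rule /= inordK ?ltnn; last by lia.
  by case: (z).
rewrite iterSr -addSnnS -(IH i.+1); [|lia..].
congr (iter _ _ _); rewrite /zstep /rule /= inordK; last by lia.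
by rewrite (_ : i < c0) /=; [case: (z) | lia].
Qed.

Lemma write_run t0 t1 i : i <= size u ->
  exists t0' t1', iter (size u - i).+1 zstep
    (at_phase Write i, t0, t1, (rev (tword (take i u)), [::])) =
  (at_phase Halt 0, t0', t1', (rev (tword u), [::])).
Proof.
move Ej: (size u - i) => j; elim: j i t0 t1 Ej => [|j IH] i t0 t1 Ej iu.
  have -> : i = size u by lia.
  rewrite /= /at_phase /rule /= inordK ?ltnn; last by rewrite ltnS leq_addl.
  by rewrite take_size; do 2!eexists.
have iu' : i < size u by lia.
have [|//|t0' [t1' it]] :=
    IH i.+1 (zact t0 (zread t0, MoveN)) (zact t1 (zread t1, MoveN)); first by lia.
exists t0', t1'; rewrite iterSr -it; congr (iter _ _ _).
rewrite /zstep /rule /= inordK; last by rewrite ltnS (leq_trans iu) ?leq_addl.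
by rewrite iu' /= (take_nth sep) // /tword map_rcons rev_rcons.
Qed.

(** The heads of tapes 0 and 2 stand at equal positions. Moving left together, they reach cell 0 at
    the same time, where tape 0 shows the mark. *)
Lemma erase_run l r t1 l2 r2 :
  mark \notin l -> head None r != mark -> size l2 = (size l).+1 -> behead r2 = [::] ->
  exists t0' t1',
    iter (size l).+2 zstep (at_phase Erase 0, (rcons l mark, r), t1, (l2, r2)) =
    (at_phase Write 0, t0', t1', ([::], [::])).
Proof.
elim: l r t1 l2 r2 => [|y l IH] r t1 [|c l2] r2 //=.
  case: l2 => //= _ rm _ r20; do 2!eexists.
  rewrite /zstep /rule /zread /= (negbTE rm) /= r20.
  by case: c.
rewrite inE negb_or eq_sym => /andP[ym yl] rm [sl2] r20.
have [||t0' [t1' it]] := IH (push y (push (head None r) (behead r)))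
  (zact t1 (zread t1, MoveN)) l2 (push c [::]) yl _ sl2.
- by rewrite -nth0 nth_push.
- by case: c.
exists t0', t1'; rewrite -it -!iterS iterSr; congr (iter _ _ _).
by rewrite /zstep /rule /zread /= (negbTE rm) /= r20.
Qed.

Lemma mark_tword v : mark \notin tword v.
Proof. by apply/mapP => -[]. Qed.

(** Induction on the unread input [z]. A symbol costs at most one increment and one rewind, within
    [2 K + 5] steps; erasing and writing happen at most once and account for [size v + size u]. *)
Lemma scan_run K x v z s : size s = K ->
  exists t t0 t1,
    t <= size z * (K.*2 + 5) + size v + size u + 4 /\
    iter t zstep (at_phase Scan 0, (rcons (rev (tword v)) mark, tword z),
      ([::], mark :: bits s), (rev (tword (x :: v)), [::])) =
    (at_phase Halt 0, t0, t1,
      (rev (tword (if 2 ^ K <= bits_val s + count_mem sep z then u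
                   else x :: v ++ z)), [::])).
Proof.
elim: z v s => [|y z IH] v s sK.
  exists 1; do 2!eexists; split; first by lia.
  by rewrite addn0 leqNgt -sK bits_val_lt /= cats0.
have l0E : csym y :: rcons (rev (tword v)) mark = rcons (rev (tword (rcons v y))) mark.
  by rewrite /tword map_rcons rev_rcons.
have l2E : csym y :: rev (tword (x :: v)) = rev (tword (x :: rcons v y)).
  by rewrite -rcons_cons /tword map_rcons rev_rcons.
have [ys|ys] := eqVneq y sep; last first.
  have [t [t0 [t1 [tT it]]]] := IH (rcons v y) s sK.
  exists t.+1, t0, t1; split; first by move: tT; rewrite size_rcons /= mulSn; lia.
  rewrite iterSr /= (negbTE ys) add0n -cat_rcons -it; congr (iter _ _ _).
  by rewrite /zstep /rule /= csym_eq (negbTE ys) l0E l2E.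
have step1 : zstep (at_phase Scan 0, (rcons (rev (tword v)) mark, tword (y :: z)),
      ([::], mark :: bits s), (rev (tword (x :: v)), [::])) =
    (at_phase Incr 0, (rcons (rev (tword (rcons v y))) mark, tword z),
      (rcons (bits [::]) mark, bits s), (rev (tword (x :: rcons v y)), [::])).
  by rewrite -l0E -l2E ys.
case E: (incr_bits s) => [s'|].
  have [ss' vs'] := incr_bits_some E.
  have [t1 [p1 [q1 [t1K p1K eqs i1]]]] := incr_run_some
    (rcons (rev (tword (rcons v y))) mark) z (rev (tword (x :: rcons v y))) [::] E.
  have [t [t0 [t1' [tT it]]]] := IH (rcons v y) s' (etrans ss' sK).
  exists (t + ((size p1).+2 + t1.+1)), t0, t1'; split.
    by move: tT p1K t1K; rewrite size_rcons sK add0n /= mulSn; lia.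
  rewrite iterD [iter (_ + _) _ _]iterD [iter t1.+1 _ _]iterSr step1.
  rewrite i1 rewind_run eqs [catrev _ _]/= it.
  by rewrite vs' /= ys eqxx cat_rcons addSnnS add1n.
(* Overflow: [bits_val s] is [2 ^ K - 1], so the current separator already reaches the threshold,
   whatever follows. *)
have [t1 i1] := incr_run_none
    (rcons (rev (tword (rcons v y))) mark) z (rev (tword (x :: rcons v y))) [::] E.
have [||||t0 [t1' i2]] := @erase_run (rev (tword (rcons v y))) (tword z) t1
    (rev (tword (x :: rcons v y))) [::].
- by rewrite mem_rev mark_tword.
- by case: (z).
- by rewrite !size_rev.
- by [].
have [t0' [t1'' i3]] := write_run t0 t1' (leq0n _).
exists ((size u - 0).+1 +
  ((size (rev (tword (rcons v y)))).+2 + (size s).+2)), t0', t1''; split.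
  by rewrite size_rev size_map size_rcons sK /= mulSn; lia.
rewrite iterD [iter (_ + _) _ _]iterD [iter (size s).+2 _ _]iterSr step1 i1 i2.
rewrite take0 in i3; rewrite i3 ifT // ys /= ?eqxx -sK -incr_bits_none //; lia.
Qed.

End Machine.

(** * The kernel as a function on words, and its running time *)

Section Kernel.
Variables (c0 : nat) (u : seq symbol).

(** On encodings [b] is the bit length of the parameter; the two header separators are
    discounted. *)
Definition kernel (w : seq symbol) : seq symbol :=
  let b := index sep (drop (index sep w).+1 w) in
  if 2 ^ (b.*2 + c0) <= count_mem sep w - 2 then u else w.

Lemma kernelE a b z : sep \notin a -> sep \notin b ->
  kernel (a ++ sep :: b ++ sep :: z) =
  if 2 ^ ((size b).*2 + c0) <= count_mem sep z then u else a ++ sep :: b ++ sep :: z.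
Proof.
move=> an bn; rewrite /kernel index_cat (negbTE an) /= ?eqxx addn0.
rewrite -cat_rcons drop_size_cat ?size_rcons // index_cat (negbTE bn) /= ?eqxx addn0.
rewrite cat_rcons !count_cat /= count_cat /= ?eqxx.
by rewrite (count_memPn an) (count_memPn bn) !add0n !add1n subn2.
Qed.

Lemma bits_val_nseq k : bits_val (nseq k false) = 0.
Proof. by elim: k => //= k ->. Qed.

(** An empty [a] does occur: it is the binary notation of zero variables, and [Init] then passes
    directly to [ReadJ]. *)
Lemma init_run a z : sep \notin a ->
  exists x v, [/\ rcons a sep = x :: v &
    iter (size a).+1 (@zstep c0 u)
      ((Init, ord0), ([::], tword (a ++ sep :: z)), ([::], [::]), ([::], [::])) =
    (at_phase c0 u ReadJ 0, (rcons (rev (tword v)) mark, tword z),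
      ([:: mark], [::]), (rev (tword (x :: v)), [::]))].
Proof.
case: a => [|x a]; first by exists sep, [::].
rewrite inE negb_or eq_sym => /andP[xs an]; exists x, (rcons a sep); split=> //.
have step1 : zstep ((Init, ord0), ([::], tword ((x :: a) ++ sep :: z)),
      ([::], [::]), ([::], [::])) =
    (at_phase c0 u ReadN 0, ([:: mark], tword (a ++ sep :: z)),
      ([:: mark], [::]), ([:: csym x], [::])).
  by rewrite /zstep /rule /= csym_eq (negbTE xs).
rewrite iterSr step1 readN_run // !catrevE.
congr (_, (_, _), _, (_, _)).
  by rewrite /tword map_rcons rev_rcons rcons_cons cats1.
by rewrite /tword /= map_rcons rev_cons rev_rcons rcons_cons cats1.
Qed.

Lemma machine_run a b z : sep \notin a -> sep \notin b ->
  let w := a ++ sep :: b ++ sep :: z in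
  exists2 t, t <= (26 + 4 * (c0 + size u)) * (size w).+1 ^ 2 &
    tm_outputs_in (machine c0 u) w t (kernel w).
Proof.
move=> an bn w; pose K := (size b).*2 + c0.
have [x [v [E i1]]] := init_run (b ++ sep :: z) an.
have i2 := @readJ_run c0 u (rcons (rev (tword v)) mark) 0
  (rev (tword (x :: v))) b z bn.
have pushE (l : seq wcell) :
    csym sep :: catrev (tword b) l = catrev (tword (rcons b sep)) l.
  by rewrite !catrevE /tword map_rcons rev_rcons.
rewrite !pushE in i2.
have i3 := @pad_run c0 u (rcons (rev (tword (v ++ rcons b sep))) mark)
  (size b).*2 (rev (tword (x :: v ++ rcons b sep))) z 0 (leq0n _).
have i4 := @rewind_run c0 u (rcons (rev (tword (v ++ rcons b sep))) mark) z
  (rev (tword (x :: v ++ rcons b sep))) (nseq K false) [::].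
have [t [t0 [t1 [tT i5]]]] := @scan_run c0 u K x (v ++ rcons b sep) z
  (nseq K false) (size_nseq _ _).
have wE : w = x :: v ++ rcons b sep ++ z.
  by rewrite /w -cat_rcons E /= cat_rcons.
exists (t + ((size (nseq K false)).+2 +
    ((c0 - 0).+1 + ((size b).*2.+1 + (size a).+1)))).
  set W := (size w).+1.
  have WE : W = size a + size b + size z + 3.
    by rewrite /W /w !size_cat /= size_cat /=; lia.
  have [av] : (size a).+1 = (size v).+1 by rewrite -(size_rcons a sep) E.
  move: tT; rewrite size_cat size_rcons size_nseq /K -av.
  move: (size u) (size a) (size b) (size z) W WE => su sa sb sz W WE tT.
  have c0W : c0 <= c0 * W by rewrite leq_pmulr ?WE ?addnS.
  have suW : su <= su * W by rewrite leq_pmulr ?WE ?addnS.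
  (* Scanning takes linearly many symbols at linear cost each; all else is linear. The constant 26
     is [9 + 17]. *)
  have zW : sz * (((sb).*2 + c0).*2 + 5) <= W * ((9 + 2 * c0) * W).
    by apply: leq_mul; lia.
  have restW : 2 * sa + 5 * sb + 2 * c0 + su + 10 <= W * ((17 + 2 * c0 + su) * W).
    apply: (@leq_trans (1 * ((17 + 2 * c0 + su) * W))).
      by lia.
    by apply: leq_mul; first lia.
  have -> : (26 + 4 * (c0 + su)) * W ^ 2 =
      W * ((9 + 2 * c0) * W) + W * ((17 + 2 * c0 + su) * W) + 3 * su * W ^ 2 by ring.
  by lia.
apply: tm_outputs_zstep.
rewrite !iterD i1 i2.
rewrite (_ : catrev _ (rcons _ _) = rcons (rev (tword (v ++ rcons b sep))) mark).
  rewrite (_ : catrev _ _ = rev (tword (x :: v ++ rcons b sep))).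
    rewrite i3 subn0 -/K i4 catrevE cats0 rev_nseq i5 bits_val_nseq.
    by rewrite kernelE // add0n -/w wE -catA.
  by rewrite catrevE -cat_cons /tword map_cat rev_cat.
by rewrite catrevE /tword map_cat rev_cat rcons_cat.
Qed.

Lemma kernel_poly_time (P : seq symbol -> Prop) :
  (forall w, P w -> exists a b z,
    [/\ sep \notin a, sep \notin b & w = a ++ sep :: b ++ sep :: z]) ->
  poly_time_on P kernel.
Proof.
move=> Pw; exists (machine c0 u), (26 + 4 * (c0 + size u)), 2.
by move=> w /Pw[a [b [z [an bn ->]]]]; apply: machine_run.
Qed.

End Kernel.

Lemma sep_binary a : sep \notin binary a.
Proof. by apply/mapP => -[]. Qed.

Lemma size_binary a : size (binary a) = up_log 2 a.+1.
Proof. by rewrite size_mkseq. Qed.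

(** Separators occur only as clause terminators, so clauses are counted without parsing literals. *)
Lemma count_sep_clauses n (ss : seq (seq (literal n))) :
  count_mem sep (flatten [seq clause_word s | s <- ss]) = size ss.
Proof.
elim: ss => //= s ss IH; rewrite count_cat IH /clause_word -cats1 count_cat.
rewrite (count_memPn _) //; apply/negP => /flattenP[_ /mapP[p _ ->]].
by rewrite inE /= (negbTE (sep_binary _)).
Qed.

(** * The fixed yes-instance *)

Section YesInstance.
Variable r : nat.

Definition pos_lits : seq (literal r) := [seq (i, true) | i <- enum 'I_r].

Lemma uniq_pos_lits : uniq pos_lits.
Proof. by rewrite map_inj_uniq ?enum_uniq // => i j []. Qed.

(** With one clause and parameter [2^-r] the target is [(1 - 2^-r) + 2^-r = 1], met by satisfying
    that clause. *)
Definition yes_instance : instance :=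
  @Instance r [set [set:: pos_lits]] (1 / 2 ^+ r)%R.

Definition yes_word : seq symbol :=
  binary r ++ sep :: binary 1 ++ sep :: flatten [:: clause_word pos_lits].

Lemma encodes_yes : encodes r yes_word yes_instance.
Proof.
exists 1, [:: pos_lits]; split=> //.
by rewrite /lists_formula /= uniq_pos_lits enum_set1 perm_refl.
Qed.

Lemma yes_instance_valid : satalb_instance r yes_instance.
Proof.
split; last by exists 1%N.
move=> Y; rewrite inE => /eqP ->; split.
  by rewrite cardsE (card_uniqP uniq_pos_lits) size_map -cardE card_ord.
move=> p; rewrite !inE => /mapP[i _ ->]; by apply/mapP => -[].
Qed.

Lemma yes_instance_yes : 0 < r -> satalb_yes r yes_instance.
Proof.
move=> r0; exists [ffun=> true].
have -> : num_sat [ffun=> true] (formula yes_instance) = 1.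
  apply/eqP/cards1P; exists [set:: pos_lits]; apply/setP => Y.
  rewrite !inE; case: eqP => //= ->; apply/existsP; exists (Ordinal r0, true).
  by rewrite inE ffunE map_f ?mem_enum.
by rewrite /num_clauses cards1 /=; lra.
Qed.

Lemma yes_instance_low : 2 <= r -> low_conflict r yes_instance.
Proof.
move=> r2; rewrite /low_conflict /conflict_number /num_clauses cards1 mulr1.
rewrite (_ : [set _ in _ | _] = set0) ?cards0.
  apply: le_trans (_ : (0 <= _)%R); first by rewrite subr_le0.
  rewrite subr_ge0 -[X in (X <= _)%R]expr1 ler_eXn2l //; lia.
apply/setP => -[Y Z]; rewrite !inE /=; apply/negP => /andP[/andP[]].
by move=> /eqP -> /eqP ->; rewrite eqxx.
Qed.

End YesInstance.

(* Correctness and size of the kernel *)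
Local Close Scope nat_scope.
Local Open Scope ring_scope.

(** Contrapositive of [num_clauses_le] at [K = j / 2^r], where [36^r / 4^r = 9^r]. *)
Lemma yes_of_many_clauses r (x : instance) (j : nat) : (0 < j)%N ->
  param x = j%:R / 2 ^+ r -> exact_cnf r (formula x) -> low_conflict r x ->
  (32 * 9 ^ r * j ^ 2 < num_clauses x)%N -> satalb_yes r x.
Proof.
move=> j0 Ek ex low big.
have K0 : 0 < param x by rewrite Ek divr_gt0 ?ltr0n // exprn_gt0.
case: (boolP [exists t : assignment (nvar x),
    (1 - 2 ^- r) * (num_clauses x)%:R + param x <= (num_sat t (formula x))%:R]).
  by move=> /existsP.
move=> /existsPn no; exfalso.
have := num_clauses_le ex K0 low.
have satK t : (num_sat t (formula x))%:R <=
    (1 - 2^-1 ^+ r) * #|formula x|%:R + param x.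
  by rewrite exprVn ltW // ltNge; apply: no.
move=> /(_ satK); apply/negP; rewrite -ltNge.
rewrite (_ : 32 * 36 ^+ r * param x ^+ 2 = (32 * 9 ^ r * j ^ 2)%:R) ?ltr_nat //.
rewrite Ek !natrM !natrX exprMn exprVn -exprM mulnC exprM.
have -> : 36 = 9 * 2 ^+ 2 :> rat by rewrite -natrX -natrM.
rewrite exprMn.
by field; rewrite expf_neq0.
Qed.

Theorem theorem3 (r : nat) (hr : (2 <= r)%N) :
  exists C : rat,
    admits_kernel (encodes r)
      (fun x => satalb_instance r x /\ low_conflict r x) (satalb_yes r)
      param num_clauses (fun k => C * k ^+ 2).
Proof.
(* Chosen so that [2^c0 = 32 * 16^r >= 32 * 9^r]. *)
pose c0 := (5 + 4 * r)%N.
(* Kept instances have [m < 2^c0 (2^L)^2 <= 2^c0 (2 j)^2] and [j^2 = 4^r k^2]. The bound [k + 1]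
   covers the parameter [2^-r] of the fixed instance. *)
exists (2 ^+ (c0 + 2) * 4 ^+ r), (kernel c0 (yes_word r)), (fun k => k + 1).
split.
  apply: kernel_poly_time => w [x _ [j [ss [_ _ ->]]]].
  by do 3!eexists; split; last reflexivity; apply: sep_binary.
move=> w x [[ex [j j0 Ek]] low] enc.
case: (enc) => j' [ss [Ek' lss Ew]].
have {Ek' Ew} Ew : w = binary (nvar x) ++ sep :: binary j ++ sep ::
    flatten [seq clause_word s | s <- ss].
  suff -> : j = j' by [].
  apply/eqP; rewrite -(eqr_nat rat); apply/eqP.
  have p0 : 2 ^- r != 0 :> rat by rewrite invr_eq0 expf_neq0.
  by apply: (mulIf p0); rewrite -Ek -Ek'.
have mE : num_clauses x = size ss.
  have /andP[_ /perm_size] := lss.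
  by rewrite size_map /num_clauses cardE.
have kE : 4 ^+ r * param x ^+ 2 = (j ^ 2)%:R.
  rewrite Ek natrX exprMn exprVn -exprM mulnC exprM (_ : 4 = 2 ^+ 2 :> rat) //.
  by field; rewrite !expf_neq0.
rewrite {1}Ew kernelE ?sep_binary // count_sep_clauses -mE size_binary -Ew.
set L := up_log 2 j.+1.
have /andP[Lj jL] : (2 ^ L.-1 < j.+1 <= 2 ^ L)%N by apply: up_log_bounds.
have {}Lj : (2 ^ L <= 2 * j)%N.
  have L0 : (0 < L)%N by rewrite lt0n; apply: contraTneq jL => ->; rewrite -ltnNge ltnS.
  by rewrite -(prednK L0) expnS leq_mul2l.
have powE : (2 ^ (L.*2 + c0) = (2 ^ L) ^ 2 * 2 ^ c0)%N.
  by rewrite expnD -muln2 expnM.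
case: leqP => [many|few].
- exists (yes_instance r); split.
  + exact: encodes_yes.
  + by split; [apply: yes_instance_valid | apply: yes_instance_low].
  + split=> _; first by apply: yes_instance_yes; apply: ltnW.
    apply: (@yes_of_many_clauses _ _ j) => //.
    (* Strictness comes from [j < 2^L]. *)
    apply: leq_trans many; rewrite powE mulnC.
    apply: (@leq_ltn_trans (j ^ 2 * 2 ^ c0)).
      rewrite leq_mul2l expnD (expnM 2 4 r) leq_mul2l.
      by rewrite [X in _ || X]leq_exp2r ?orbT //; lia.
    by rewrite ltn_pmul2r ?expn_gt0 // ltn_exp2r.
  + have : 2 ^- r <= 1 :> rat by rewrite invf_le1 ?exprn_gt0 // exprn_ege1 // ler1n.
    have : 0 <= param x by rewrite Ek divr_ge0 // exprn_ge0.
    by rewrite /=; lra.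
  + rewrite /num_clauses cards1 -mulrA kE -natrX -natrM ler_nat muln_gt0.
    by rewrite !expn_gt0 j0.
- exists x; split=> //; [by split=> //; split=> //; exists j | by rewrite lerDl |].
  rewrite -mulrA kE -natrX -natrM ler_nat; apply: leq_trans (ltnW few) _.
  rewrite powE mulnC expnD -mulnA leq_mul2l; apply/orP; right.
  by rewrite -(expnMn 2 j 2) leq_exp2r.
Qed.
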